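(* For all natural numbers $m\ge n$, there exist coverings $\Gamma_m\to\Gamma_n$ and $\Gamma\to\Gamma_n$, where $\Gamma$ is the Pascal graph and $\Gamma_0$ is the complete graph on four points with $\Gamma_{n+1}=\hat\Gamma_n$. Let $f(X)=X^2-X-3$, $k(X)=X+2$, $l(X)=X$, $\mathrm m(X)=X-2$, and let $\Delta$ be the operator $\Delta\varphi(p)=\sum_{q\sim p}\varphi(q)$. For every natural number $n$, the characteristic polynomial of $\Delta$ in $\ell^2(\Gamma_n)$ is $$(X-3)(X+1)^3\prod_{p=0}^{n-1}\bigl(\mathrm m\circ f^p(X)\bigr)^3\bigl(l\circ f^p(X)\bigr)^{2\cdot3^{n-1-p}}\bigl(k\circ f^p(X)\bigr)^{1+2\cdot3^{n-1-p}},$$ where $f^p$ is the $p$-th iterate of $f$.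
   Context: A graph is a set with a symmetric irreflexive relation $\sim$. A map $\varpi:\Phi\to\Psi$ between graphs is a covering if for every $p\in\Phi$ it induces a bijection from the set of neighbours of $p$ onto the set of neighbours of $\varpi(p)$. A graph $\Phi$ is regular of valence $3$ with boundary if every point has two or three neighbours; $\partial\Phi$ is the set of points with exactly two neighbours (empty when $\Phi$ is regular of valence $3$). For such $\Phi$, $\hat\Phi$ is the graph on the set $\partial\Phi\cup\{(p,q):p,q\in\Phi,\ p\sim q\}$ whose adjacencies are: $(p,q)\sim(q,p)$ whenever $p\sim q$; $(p,q)\sim(p,r)$ whenever $q\ne r$ are neighbours of $p$; and $p\sim(p,q)$ whenever $p\in\partial\Phi$ and $q\sim p$. It is again regular of valence $3$ with boundary, and $\partial\hat\Phi=\partial\Phi$. For distinct $a,b,c$, $\mathcal T_1(a,b,c)$ is the complete graph on $\{a,b,c\}$ and $\mathcal T_{n+1}(a,b,c)=\widehat{\mathcal T_n(a,b,c)}$; it has boundary $\{a,b,c\}$. For $n\ge2$ there are unique elements $ab,ba,ac,ca,bc,cb$ of $\mathcal T_n(a,b,c)$ such that $\mathcal T_n(a,b,c)$ is the union of three subgraphs $\mathcal T_{n-1}(a,ab,ac)$, $\mathcal T_{n-1}(b,ba,bc)$, $\mathcal T_{n-1}(c,ca,cb)$ with $ab\sim ba$, $ac\sim ca$, $bc\sim cb$. The infinite triangle $\mathcal T_\infty(a)$ is the increasing union of graphs $\mathcal T_n(a,b_n,c_n)$, $n\ge1$, where $\mathcal T_n(a,b_n,c_n)$ is identified with the subgraph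 $\mathcal T_n(a,ab_{n+1},ac_{n+1})$ of $\mathcal T_{n+1}(a,b_{n+1},c_{n+1})$ by the unique graph isomorphism sending $a\mapsto a$, $b_n\mapsto ab_{n+1}$, $c_n\mapsto ac_{n+1}$. The Pascal graph $\Gamma$ is the disjoint union of two infinite triangles $\mathcal T_\infty(p_0)$ and $\mathcal T_\infty(p_0^\vee)$ with the one additional edge $p_0\sim p_0^\vee$. *)

(* Defs.v *)
From HB Require Import structures.
From mathcomp Require Import all_boot all_algebra.
From mathcomp Require Import generic_quotient boolp classical_sets functions.
From mathcomp Require Import reals complex.

Set Implicit Arguments.
Unset Strict Implicit.
Unset Printing Implicit Defensive.

Import GRing.Theory.
Local Open Scope nat_scope.
Local Open Scope quotient_scope.

HB.mixin Record isGraph V of Choice V := {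
  adj : rel V;
  adj_sym : symmetric adj;
  adj_irr : irreflexive adj
}.
#[short(type="graphType")]
HB.structure Definition Graph := { V of isGraph V & Choice V }.
#[short(type="finGraphType")]
HB.structure Definition FinGraph := { V of isGraph V & Finite V }.

Definition covering (G H : graphType) (f : G -> H) : Prop :=
  forall p : G,
    set_bij [set q | adj p q]%classic [set s | adj (f p) s]%classic f.

Definition complete_point (V : finType) : Type := V.
HB.instance Definition _ (V : finType) := Finite.on (complete_point V).

Section Complete.
Variable V : finType.
Definition complete_adj : rel (complete_point V) := fun p q => p != q.
Fact complete_sym : symmetric complete_adj.
Proof. by move=> p q; rewrite /complete_adj eq_sym. Qed.
Fact complete_irr : irreflexive complete_adj.
Proof. by move=> p; rewrite /complete_adj eqxx. Qed.
HB.instance Definition _ :=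
  isGraph.Build (complete_point V) complete_sym complete_irr.

Definition complete : finGraphType := FinGraph.clone (complete_point V) _.
End Complete.

(* On graphs all of whose points have two or three neighbours this is the
   boundary; [boundary] and [hat] make sense for any finite graph. *)
Definition boundary (G : finGraphType) : {set G} :=
  [set p | #|[set q | adj p q]| == 2].

Definition hat_point (G : finGraphType) : Type :=
  ({p : G | p \in boundary G} + {pq : G * G | adj pq.1 pq.2})%type.
HB.instance Definition _ (G : finGraphType) := Finite.on (hat_point G).

Section Hat.
Variable G : finGraphType.

Definition hat_adj : rel (hat_point G) := fun u v =>
  match u, v with
  | inl _, inl _ => false
  | inl p, inr e | inr e, inl p => val p == (val e).1
  | inr d, inr e =>
         ((val d).1 == (val e).2) && ((val d).2 == (val e).1)
      || ((val d).1 == (val e).1) && ((val d).2 != (val e).2)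
  end.

Fact hat_sym : symmetric hat_adj.
Proof.
move=> [p|d] [q|e] //=.
by rewrite andbC ![(val e).1 == _]eq_sym ![(val e).2 == _]eq_sym.
Qed.

Fact hat_irr : irreflexive hat_adj.
Proof.
move=> [p|[[p q] /= pq]] //=; rewrite !eqxx /= orbF.
by apply/negbTE/negP => /andP[/eqP pq' _]; move: pq; rewrite pq' adj_irr.
Qed.

HB.instance Definition _ := isGraph.Build (hat_point G) hat_sym hat_irr.

Definition hat : finGraphType := FinGraph.clone (hat_point G) _.

Definition hat_src (u : hat) : G :=
  match u with inl p => val p | inr e => (val e).1 end.
Definition hat_dst (u : hat) : option G :=
  match u with inl p => None | inr e => Some (val e).2 end.

Lemma hat_inj (u v : hat) :
  hat_src u = hat_src v -> hat_dst u = hat_dst v -> u = v.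
Proof.
case: u v => [p|[[p q] /= pq]] [r|[[r s] /= rs]] //=.
  by move=> /val_inj->.
by move=> pr [qs]; congr inr; apply: val_inj; rewrite /= pr qs.
Qed.

Lemma hat_adjE (u v : hat) : adj u v =
     (hat_src u == hat_src v) && (hat_dst u != hat_dst v)
  || (hat_dst u == Some (hat_src v)) && (hat_dst v == Some (hat_src u)).
Proof.
case: u v => [p|[[p q] /= pq]] [r|[[r s] /= rs]] /=; rewrite /adj/= ?andbF //.
- by rewrite andbT orbF.
- by rewrite andbT orbF eq_sym.
by rewrite orbC (inj_eq Some_inj) !(inj_eq Some_inj) [s == p]eq_sym [in RHS]andbC
  [(q == r) && _]andbC [in RHS]andbC.
Qed.

Fact hat_boundary_subproof (p : {p : G | p \in boundary G}) :
  inl p \in boundary hat.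
Proof.
have := valP p; rewrite /= !inE => /eqP <-.
rewrite -(card_in_imset (f := fun u : hat => odflt (val p) (hat_dst u))).
  apply/eqP/eq_card => q; apply/imsetP/idP.
    move=> [u]; rewrite inE => pu ->; rewrite inE.
    by case: u pu => [r|[[r s] /= rs]] // /eqP /= ->.
  rewrite inE => pq.
  by exists (inr (exist _ (val p, q) pq)); rewrite ?inE /adj /=.
move=> [r|[[r s] /= rs]] [r'|[[r' s'] /= rs']]; rewrite !inE //=.
move=> /eqP /= pr /eqP /= pr' ss'; congr inr; apply: val_inj.
by rewrite /= -pr -pr' ss'.
Qed.

Definition hat_boundary (p : {p : G | p \in boundary G}) :
    {u : hat | u \in boundary hat} :=
  exist _ (inl p) (hat_boundary_subproof p).

(* The point (p, q) of hat; the value x is never used when p ~ q. *)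
Definition arrow (x : hat) (p q : G) : hat :=
  if insub (p, q) is Some e then inr e else x.

Lemma arrow_srcE x p q : adj p q -> hat_src (arrow x p q) = p.
Proof. by move=> pq; rewrite /arrow insubT. Qed.
Lemma arrow_dstE x p q : adj p q -> hat_dst (arrow x p q) = Some q.
Proof. by move=> pq; rewrite /arrow insubT. Qed.

Lemma hat_boundaryE (u : hat) :
  (forall p : G, 1 < #|[set q | adj p q]|) ->
  1 < #|[set v | adj u v]| /\ (u \in boundary hat -> hat_dst u = None).
Proof.
move=> deg2; case: u => [p|[[p q] /= pq]].
  have := hat_boundary_subproof p; rewrite inE => /eqP ->; by split.
suff : 2 < #|[set v | adj (inr (exist _ (p, q) pq) : hat) v]|.
  by move=> h; split; [apply: ltnW | rewrite inE => /eqP e; rewrite e in h].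
have qp : adj q p by rewrite adj_sym.
have pq_neq : p != q by apply: contraTneq pq => ->; rewrite adj_irr.
pose N := [set q' | adj p q'].
have card3 (a b c : hat) : a != b -> a != c -> b != c ->
  adj (inr (exist _ (p, q) pq) : hat) a ->
  adj (inr (exist _ (p, q) pq) : hat) b ->
  adj (inr (exist _ (p, q) pq) : hat) c ->
  2 < #|[set v | adj (inr (exist _ (p, q) pq) : hat) v]|.
  move=> ab ac bc ha hb hc.
  have -> : 3 = #|[set a; b; c]|.
    by rewrite -finset.setUA !cardsU1 cards1 !inE negb_or ab ac bc.
  by apply/subset_leq_card/fintype.subsetP => v; rewrite !inE -orbA => /or3P[] /eqP->.
have arr r (pr : adj p r) : r != q ->
    adj (inr (exist _ (p, q) pq) : hat) (inr (exist _ (p, r) pr)).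
  by move=> rq; rewrite /adj /= eqxx [q == r]eq_sym rq orbT.
have rev : adj (inr (exist _ (p, q) pq) : hat) (inr (exist _ (q, p) qp)).
  by rewrite /adj /= !eqxx.
have cardN : #|N :\ q| = #|N|.-1 by rewrite (cardsD1 q N) inE pq.
case bp : (p \in boundary G).
  have /card_gt0P[r] : 0 < #|N :\ q| by rewrite cardN -subn1 subn_gt0 deg2.
  rewrite !inE => /andP[rq pr].
  apply: (@card3 (inr (exist _ (q, p) qp)) (inr (exist _ (p, r) pr))
                 (inl (exist _ p bp))) => //.
  - by apply/eqP => - [] e; rewrite e eqxx in pq_neq.
  - exact: arr.
  - by rewrite /adj /=.
have : 1 < #|N :\ q|.
  rewrite cardN; have := deg2 p; rewrite -/N; have := bp.
  by rewrite inE -/N; case: #|N| => [|[|[|]]].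
move=> /card_gt1P[r [s [rN sN rs]]].
move: rN sN; rewrite !inE => /andP[rq pr] /andP[sq ps].
apply: (@card3 (inr (exist _ (q, p) qp)) (inr (exist _ (p, r) pr))
               (inr (exist _ (p, s) ps))) => //; try exact: arr.
- by apply/eqP => - [] e; rewrite e eqxx in pq_neq.
- by apply/eqP => - [] e; rewrite e eqxx in pq_neq.
- by apply/eqP => - [] e; rewrite e eqxx in rs.
Qed.
End Hat.

Fixpoint Gamma (n : nat) : finGraphType :=
  if n is n'.+1 then hat (Gamma n') else complete 'I_4.

(* [triangle n] is T_(n+1)(a, b, c), the labels a, b, c being the elements
   0, 1, 2 of 'I_3. *)
Fixpoint triangle (n : nat) : finGraphType :=
  if n is n'.+1 then hat (triangle n') else complete 'I_3.

Fact triangle0_boundary (i : triangle 0) : i \in boundary (triangle 0).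
Proof.
rewrite inE; apply/eqP; transitivity #|[set~ i]|.
  by apply: eq_card => j; rewrite !inE /adj /= /complete_adj eq_sym.
by rewrite cardsC1 card_ord.
Qed.

Fixpoint boundary_corner (n : nat) (i : 'I_3) :
    {p : triangle n | p \in boundary (triangle n)} :=
  if n is n'.+1 then hat_boundary (boundary_corner n' i)
  else exist _ (i : triangle 0) (triangle0_boundary i).

Definition corner (n : nat) (i : 'I_3) : triangle n :=
  val (boundary_corner n i).

Definition corner_label (n : nat) (p : triangle n) : 'I_3 :=
  odflt ord0 [pick i | corner n i == p].

(* [subtriangle n i] embeds T_(n+1) into T_(n+2) as the subtriangle at the
   corner i; thus subtriangle n i (corner n j) is the point written ab, for a
   the corner i and b the corner j <> i.  That this is the decomposition of
   T_(n+2) into three subtriangles is [subtriangle_decomposition]. *)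
Fixpoint subtriangle (n : nat) (i : 'I_3) {struct n} :
    triangle n -> triangle n.+1 :=
  match n with
  | 0 => fun j => if j == i then corner 1 i else arrow (corner 1 i) i j
  | n'.+1 => fun u =>
      match u with
      | inl p =>
          let j := corner_label (val p) in
          if j == i then corner n'.+2 i
          else arrow (corner n'.+2 i) (subtriangle i (corner n' j))
                                      (subtriangle j (corner n' i))
      | inr e =>
          arrow (corner n'.+2 i) (subtriangle i (val e).1)
                                 (subtriangle i (val e).2)
      end
  end.

Lemma corner_inj n : injective (corner n).
Proof.
by elim: n => [|n IH] i j //; rewrite /corner /= => -[e]; apply: IH; rewrite /corner e.
Qed.

Lemma cornerK n i : corner_label (corner n i) = i.
Proof.
rewrite /corner_label; case: pickP => [j /eqP /corner_inj //|/(_ i)].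
by rewrite eqxx.
Qed.

Lemma triangle_boundary n :
  (forall p : triangle n, 1 < #|[set q | adj p q]|) /\
  (forall p : triangle n, p \in boundary (triangle n) -> exists i, p = corner n i).
Proof.
elim: n => [|n [deg2 bdE]].
  split=> p; last by exists p.
  by have := triangle0_boundary p; rewrite inE => /eqP ->.
split=> u; first by have [] := hat_boundaryE u deg2.
have [_ h] := hat_boundaryE u deg2 => /h; case: u {h} => // p _.
have [i pi] := bdE _ (valP p).
by exists i; rewrite /corner /=; congr inl; apply: val_inj.
Qed.

Theorem subtriangle_decomposition n :
  [/\ (forall i (p q : triangle n),
         adj (subtriangle i p) (subtriangle i q) = adj p q),
      (forall i, subtriangle i (corner n i) = corner n.+1 i),
      (forall u : triangle n.+1, exists i p, u = subtriangle i p),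
      (forall i j (p q : triangle n),
         subtriangle i p = subtriangle j q -> i = j /\ p = q) &
      (forall i j (p q : triangle n), i != j ->
         adj (subtriangle i p) (subtriangle j q) =
         (p == corner n j) && (q == corner n i))].
Proof.
elim: n => [|n [IHadj IHcorner IHcover IHinj IHcross]].
  have src i (j : triangle 0) : hat_src (@subtriangle 0 i j) = i.
    rewrite /=; case: eqP => // /eqP ji; rewrite arrow_srcE //.
    by rewrite /adj /= /complete_adj eq_sym.
  have dst i (j : triangle 0) : hat_dst (@subtriangle 0 i j) =
      if j == i then None else Some j.
    rewrite /=; case: eqP => // /eqP ji; rewrite arrow_dstE //.
    by rewrite /adj /= /complete_adj eq_sym.
  have srcadj (p q : triangle 0) : adj p q = (p != q) by [].
  split.
  - move=> i p q; rewrite hat_adjE !src !dst eqxx srcadj /=.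
    suff h (a b c : 'I_3) :
        ((if b == a then None else Some b) != (if c == a then None else Some c))
        || ((if b == a then None else Some b) == Some a) &&
           ((if c == a then None else Some c) == Some a) = (b != c) by exact: h.
    by move: a b c => [[|[|[|?]]] ?] [[|[|[|?]]] ?] [[|[|[|?]]] ?].
  - by move=> i; rewrite /= eqxx.
  - move=> u; exists (hat_src u), (odflt (hat_src u) (hat_dst u)).
    apply: hat_inj; rewrite ?src ?dst //.
    case: u => [p|[[p q] /= pq]] /=; first by rewrite eqxx.
    by move: pq; rewrite srcadj eq_sym => /negbTE ->.
  - move=> i j p q e; have ij : i = j by rewrite -(src i p) e src.
    split=> //; move: (congr1 (@hat_dst _) e); rewrite !dst ij.
    suff h (a b c : 'I_3) : (if b == a then None else Some b) =
        (if c == a then None else Some c) -> b = c by exact: h.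
    by move: a b c => [[|[|[|?]]] ?] [[|[|[|?]]] ?] [[|[|[|?]]] ?] //= _;
      apply: val_inj.
  - move=> i j p q ij; rewrite hat_adjE !src !dst (negbTE ij) /corner /=.
    suff h (a b c d : 'I_3) : a != b ->
        ((if c == a then None else Some c) == Some b) &&
        ((if d == b then None else Some d) == Some a) = (c == b) && (d == a)
      by exact: h.
    by move: a b c d => [[|[|[|?]]] ?] [[|[|[|?]]] ?] [[|[|[|?]]] ?] [[|[|[|?]]] ?].
have cadj i j : i != j ->
    adj (subtriangle i (corner n j)) (subtriangle j (corner n i)).
  by move=> ij; rewrite IHcross // !eqxx.
have src i (u : triangle n.+1) :
    hat_src (@subtriangle n.+1 i u) = subtriangle i (hat_src u).
  case: u => [p|[[p q] /= pq]] /=; last by rewrite arrow_srcE // IHadj.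
  have [j pj] := (triangle_boundary n).2 _ (valP p).
  rewrite pj cornerK; case: eqVneq => [->|ji].
    by rewrite IHcorner.
  by rewrite arrow_srcE // cadj // eq_sym.
have dstS i (p q : triangle n) pq :
    hat_dst (@subtriangle n.+1 i (inr (exist _ (p, q) pq))) =
    Some (subtriangle i q).
  by rewrite /= arrow_dstE // IHadj.
have dstN i j : hat_dst (@subtriangle n.+1 i (corner n.+1 j)) =
    if j == i then None else Some (subtriangle j (corner n i)).
  rewrite /= -/(corner n j) cornerK; case: eqVneq => // ji.
  by rewrite arrow_dstE // cadj // eq_sym.
have hatPm m (P : triangle m.+1 -> Prop) : (forall j, P (corner m.+1 j)) ->
    (forall (p q : triangle m) pq, P (inr (exist _ (p, q) pq))) ->
    forall u, P u.
  move=> Pc Pa [p|[[p q] pq]] //.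
  have [j pj] := (triangle_boundary m).2 _ (valP p).
  by have -> : inl p = corner m.+1 j by rewrite /corner /=; congr inl; apply: val_inj.
have hatP := @hatPm n.
have srcC j : hat_src (corner n.+1 j) = corner n j by [].
have dstC j : hat_dst (corner n.+1 j) = None by [].
have subI i : injective (@subtriangle n i) by move=> p q /IHinj[].
have subD i j p q : i != j -> (@subtriangle n i p == subtriangle j q) = false.
  by move=> ij; apply/eqP => /IHinj[e]; rewrite e eqxx in ij.
have dstA i (u : triangle n.+1) (p : triangle n) :
    (hat_dst (@subtriangle n.+1 i u) == Some (subtriangle i p)) =
    (hat_dst u == Some p).
  elim/hatP: u => [j|q r qr]; last first.
    by rewrite dstS !(inj_eq Some_inj) (inj_eq (@subI i)).
  rewrite dstN dstC; case: (eqVneq j i) => // ji.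
  by rewrite (inj_eq Some_inj) subD.
have dstB i j (u : triangle n.+1) (p : triangle n) : i != j ->
    (hat_dst (@subtriangle n.+1 i u) == Some (subtriangle j p)) =
    (u == corner n.+1 j) && (p == corner n i).
  move=> ij; elim/hatP: u => [k|q r qr]; last first.
    by rewrite dstS (inj_eq Some_inj) subD.
  rewrite dstN (inj_eq (@corner_inj n.+1)).
  case: (eqVneq k i) => [->|ki]; first by rewrite (negbTE ij).
  rewrite (inj_eq Some_inj); case: (eqVneq k j) => [->|kj]; last by rewrite subD.
  by rewrite (inj_eq (@subI j)) eq_sym.
have dstI i (u v : triangle n.+1) : hat_src u = hat_src v ->
    (hat_dst (@subtriangle n.+1 i u) == hat_dst (@subtriangle n.+1 i v)) =
    (hat_dst u == hat_dst v).
  elim/hatP: v => [j|p q pq]; last by rewrite dstS dstA.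
  elim/hatP: u => [k|p q pq]; last first.
    by move=> _; rewrite [LHS]eq_sym dstS dstA eq_sym.
  by rewrite !srcC => /corner_inj ->; rewrite !eqxx.
split.
- move=> i p q; rewrite !hat_adjE !src !dstA (inj_eq (@subI i)).
  by case: eqP => //= e; rewrite dstI.
- by move=> i; rewrite /= -/(corner n i) cornerK eqxx.
- elim/(@hatPm n.+1) => [j|v w vw].
    by exists j, (corner n.+1 j); rewrite /= -/(corner n j) cornerK eqxx.
  have [i [p vE]] := IHcover v; have [j [q wE]] := IHcover w.
  case: (eqVneq i j) => [ij|ij].
    have pq : adj p q by rewrite -(IHadj i) -vE ij -wE.
    exists i, (inr (exist _ (p, q) pq)).
    by apply: hat_inj; rewrite ?src ?dstS /= ?vE ?wE ?ij.
  have /andP[/eqP pE /eqP qE] : (p == corner n j) && (q == corner n i).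
    by rewrite -IHcross // -vE -wE.
  exists i, (corner n.+1 j); apply: hat_inj; rewrite ?src ?dstN /=.
    by rewrite vE pE.
  by rewrite eq_sym (negbTE ij) wE qE.
- move=> i j p q e.
  have [ij pq] : i = j /\ hat_src p = hat_src q.
    by apply: IHinj; rewrite -!src e.
  split=> //; apply: hat_inj => //; apply/eqP.
  by rewrite -(dstI i) // e ij.
- move=> i j p q ij; rewrite hat_adjE !src subD // dstB // dstB 1?eq_sym //.
  apply/andP/andP => [[/andP[-> _] /andP[-> _]] //|[/eqP-> /eqP->]].
  by rewrite !srcC !eqxx.
Qed.

(* Increasing unions, as direct limits of sequences of embeddings onto induced
   subgraphs. *)
Record tower := Tower {
  stage : nat -> finGraphType;
  incl : forall n, stage n -> stage n.+1;
  incl_inj : forall n, injective (@incl n);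
  incl_adj : forall n p q, adj (@incl n p) (@incl n q) = adj p q
}.

Section Union.
Variable T : tower.

Definition shift (x : {n & stage T n}) : {n & stage T n} :=
  existT _ (tag x).+1 (@incl T (tag x) (tagged x)).

Definition identified : rel {n & stage T n} := fun x y =>
  `[< exists i j, iter i shift x = iter j shift y >].

Fact identified_refl : reflexive identified.
Proof. by move=> x; apply/asboolP; exists 0, 0. Qed.
Fact identified_sym : symmetric identified.
Proof. by move=> x y; apply/asboolP/asboolP => -[i [j e]]; exists j, i. Qed.
Fact identified_trans : transitive identified.
Proof.
move=> y x z /asboolP[i [j xy]] /asboolP[k [l yz]]; apply/asboolP.
by exists (k + i), (j + l); rewrite !iterD xy -yz -!iterD addnC.
Qed.

Canonical identified_equiv :=
  EquivRel identified identified_refl identified_sym identified_trans.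

Definition union_point : Type := {eq_quot identified}.
HB.instance Definition _ := Choice.copy union_point {eq_quot identified}.

Definition in_union (n : nat) (p : stage T n) : union_point :=
  \pi_{eq_quot identified} (existT _ n p).

Definition union_adj : rel union_point := fun u v =>
  `[< exists n (p q : stage T n),
        [/\ u = in_union p, v = in_union q & adj p q] >].

Lemma in_union_inj n : injective (@in_union n).
Proof.
move=> p q /eqmodP /asboolP[i [j e]].
have tag_iter k (x : {n & stage T n}) : tag (iter k shift x) = tag x + k.
  by elim: k => [|k IH]; rewrite ?addn0 // iterS /= IH addnS.
have ij : i = j.
  by move: (congr1 (@tag _ _) e); rewrite !tag_iter => /addnI.
have shift_inj : injective shift.
  move=> [m x] [m' y] /eqP; rewrite /shift /= => /eqP h.
  have mm' : m = m' by move: (congr1 (@tag _ _) h) => /= -[].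
  case: m' / mm' y h => y /eqP; rewrite eq_Tagged /= => /eqP /incl_inj ->.
  by [].
have {e} := e; rewrite ij; elim: j {ij} => [|j IH] /=.
  by move=> /eqP; rewrite eq_Tagged => /eqP.
by move=> /shift_inj.
Qed.

Lemma in_union_incl n (p : stage T n) : in_union (incl p) = in_union p.
Proof. by apply/eqmodP/asboolP; exists 0, 1. Qed.

Lemma in_union_surj (u : union_point) : exists n (p : stage T n), u = in_union p.
Proof.
exists (tag (repr u)), (tagged (repr u)).
by rewrite /in_union -[LHS]reprK; case: (repr u).
Qed.

Fact union_sym : symmetric union_adj.
Proof.
by move=> u v; apply/asboolP/asboolP => -[n [p [q [-> -> pq]]]];
  exists n, q, p; split=> //; rewrite adj_sym.
Qed.
Fact union_irr : irreflexive union_adj.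
Proof.
move=> u; apply/negbTE/asboolPn => -[n [p [q [-> /in_union_inj -> ]]]].
by rewrite adj_irr.
Qed.
HB.instance Definition _ := isGraph.Build union_point union_sym union_irr.

Definition union : graphType := Graph.clone union_point _.
End Union.

Fact subtriangle0_inj n : injective (@subtriangle n ord0).
Proof. by have [_ _ _ h _] := subtriangle_decomposition n => p q /h[]. Qed.
Fact subtriangle0_adj n (p q : triangle n) :
  adj (subtriangle ord0 p) (subtriangle ord0 q) = adj p q.
Proof. by have [h _ _ _ _] := subtriangle_decomposition n. Qed.

(* T_n(a, b_n, c_n) is embedded at the corner a, so that a, b_n, c_n go to
   a, ab_(n+1), ac_(n+1). *)
Definition triangle_tower : tower :=
  @Tower triangle (fun n => @subtriangle n ord0)
    subtriangle0_inj subtriangle0_adj.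

Definition infinite_triangle : graphType := union triangle_tower.

Definition apex : infinite_triangle :=
  @in_union triangle_tower 0 (corner 0 ord0).

Definition pascal_point : Type := (infinite_triangle + infinite_triangle)%type.
HB.instance Definition _ := Choice.on pascal_point.

Definition pascal_adj : rel pascal_point := fun u v =>
  match u, v with
  | inl p, inl q | inr p, inr q => adj p q
  | inl p, inr q | inr p, inl q => (p == apex) && (q == apex)
  end.
Fact pascal_sym : symmetric pascal_adj.
Proof. by move=> [p|p] [q|q]; rewrite /= 1?adj_sym 1?andbC. Qed.
Fact pascal_irr : irreflexive pascal_adj.
Proof. by move=> [p|p]; rewrite /= adj_irr. Qed.
HB.instance Definition _ := isGraph.Build pascal_point pascal_sym pascal_irr.

Definition pascal : graphType := Graph.clone pascal_point _.

Local Open Scope ring_scope.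

Section Laplace.
Variables (R : realType) (G : finGraphType).

(* As G is finite, l^2(G) is the space of all complex functions on G. *)
Local Notation ell2 := {ffun G -> R[i]^o}.

Definition Delta_fun (phi : ell2) : ell2 :=
  [ffun p => \sum_(q | adj p q) phi q].

Fact Delta_fun_linear : linear Delta_fun.
Proof.
move=> a phi psi; apply/ffunP => p; rewrite !ffunE scaler_sumr -big_split /=.
by apply: eq_bigr => q _; rewrite !ffunE.
Qed.
HB.instance Definition _ :=
  GRing.isLinear.Build _ _ _ _ Delta_fun Delta_fun_linear.

Definition Delta : 'End(ell2) := linfun Delta_fun.
End Laplace.

(* det(X - f), computed in the basis [vbasis {:V}]; the result does not depend
   on the choice of the basis. *)
Definition char_poly_end (F : fieldType) (V : vectType F) (f : 'End(V)) :
    {poly F} :=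
  char_poly (passmx.mxof (vbasis {:V}) (vbasis {:V}) f).

Section Polynomials.
Variable R : realType.
Definition f_poly : {poly R[i]} := 'X^2 - 'X - 3%:P.
Definition k_poly : {poly R[i]} := 'X + 2%:P.
Definition l_poly : {poly R[i]} := 'X.
Definition m_poly : {poly R[i]} := 'X - 2%:P.
Definition f_iter (p : nat) : {poly R[i]} :=
  iter p (fun q => f_poly \Po q) 'X.
End Polynomials.

(* Main.v *)
(** For a cubic graph [G] on [2k] points, let [S] be the source-incidence matrix
    of the arrows of [G] and [T] the matrix reversing the arrows.  Then
    [S S^T = 3], [S T S^T] is the adjacency matrix of [G], and that of [hat G]
    is [S^T S - 1 + T].  As [(X + 1 - T) (X + 1 + T) = X (X + 2)], a Schur
    complement gives [chi_(hat G) = (X (X + 2))^k (chi_G o f)], whence the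
    spectra by induction from [f - 3 = (X - 3) k] and [f + 1 = (X + 1) m].

    An immersion (a locally injective graph morphism) into a cubic graph maps a
    point of valence 2 so that exactly one neighbour of its image is missed, so
    it extends functorially to [hat].  Hence the coverings [Gamma_m -> Gamma_n]
    come from the covering [(p, q) |-> q] of [Gamma_0] by [hat Gamma_0].  The
    coverings by the Pascal graph are glued from immersions of the finite
    triangles, and [hat] carries a compatible family of these into [Gamma_n] to
    one into [Gamma_(n+1)].  A family into [Gamma_0] is built by iterating
    [(p, q) |-> q] on [hat], followed each time by the transposition of [0] and
    [3]: without it, the colour of the apex would alternate. *)

From HB Require Import structures.
Require Import Defs.
From mathcomp Require Import all_boot all_fingroup all_algebra.
From mathcomp Require Import reals complex.
From mathcomp Require boolp classical_sets functions generic_quotient.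
From mathcomp Require Import zify ring.

Set Implicit Arguments.
Unset Strict Implicit.
Unset Printing Implicit Defensive.

Import GRing.Theory Num.Theory passmx.

(** * Arrows of a cubic graph *)

Definition cubic (G : finGraphType) : Prop :=
  forall p : G, #|[set q | adj p q]| = 3.

Lemma hat_dst_boundary (G : finGraphType) (u : hat G) :
  hat_dst u = None -> hat_src u \in boundary G.
Proof. by case: u => // p _; apply: valP. Qed.

Lemma hat_dst_adj (G : finGraphType) (u : hat G) q :
  hat_dst u = Some q -> adj (hat_src u) q.
Proof. by case: u => // -[[p r] /= pr] [<-]. Qed.

Lemma hat_arrow_ex (G : finGraphType) (p q : G) :
  adj p q -> exists u : hat G, hat_src u = p /\ hat_dst u = Some q.
Proof. by move=> pq; exists (inr (exist _ (p, q) pq)). Qed.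

Section CubicHat.
Variable G : finGraphType.
Hypothesis G3 : cubic G.
Implicit Types u v : hat G.

(** The default is never reached under [G3]: a cubic graph has empty boundary, so every point of
    [hat G] is an arrow. *)
Definition hat_tgt u : G := odflt (hat_src u) (hat_dst u).

Lemma hat_dstE u : hat_dst u = Some (hat_tgt u).
Proof.
rewrite /hat_tgt; case E : (hat_dst u) => [q|] //.
by have := hat_dst_boundary E; rewrite inE G3.
Qed.

Lemma hat_tgt_adj u : adj (hat_src u) (hat_tgt u).
Proof. exact/hat_dst_adj/hat_dstE. Qed.

Lemma hat_ext u v : hat_src u = hat_src v -> hat_tgt u = hat_tgt v -> u = v.
Proof. by move=> s t; apply: hat_inj => //; rewrite !hat_dstE t. Qed.

Definition hat_flip u : hat G := arrow u (hat_tgt u) (hat_src u).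

Lemma hat_flip_src u : hat_src (hat_flip u) = hat_tgt u.
Proof. by rewrite arrow_srcE // adj_sym hat_tgt_adj. Qed.

Lemma hat_flip_tgt u : hat_tgt (hat_flip u) = hat_src u.
Proof. by rewrite /hat_tgt arrow_dstE //= adj_sym hat_tgt_adj. Qed.

Lemma hat_flipK : involutive hat_flip.
Proof.
by move=> u; apply: hat_ext; rewrite ?(hat_flip_src, hat_flip_tgt).
Qed.

Lemma hat_flip_neq u : hat_src (hat_flip u) != hat_src u.
Proof.
by rewrite hat_flip_src; apply: contraTneq (hat_tgt_adj u) => ->; rewrite adj_irr.
Qed.

(** By [hat_ext], arrows with the same source differ as soon as their targets do. Thus [hat G]
    consists of triangles, one per point of [G], joined by the perfect matching [hat_flip]. *)
Lemma cubic_hat_adjE u v :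
  adj u v = (hat_src u == hat_src v) && (u != v) || (u == hat_flip v).
Proof.
rewrite hat_adjE !hat_dstE !(inj_eq Some_inj).
have -> : (u == hat_flip v) = (hat_tgt u == hat_src v) && (hat_tgt v == hat_src u).
  apply/eqP/andP => [->|[/eqP tu /eqP tv]].
    by rewrite hat_flip_src hat_flip_tgt !eqxx.
  by apply: hat_ext; rewrite ?hat_flip_src ?hat_flip_tgt.
congr (_ || _); case: eqP => //= s; congr (~~ _).
by apply/eqP/eqP => [t|-> //]; apply: hat_ext.
Qed.

Lemma card_hat_src (p : G) : #|[set u : hat G | hat_src u == p]| = 3.
Proof.
rewrite -(G3 p) -(card_in_imset (f := hat_tgt)).
  apply: eq_card => q; rewrite inE; apply/imsetP/idP => [[u]|pq].
    by rewrite inE => /eqP <- ->; apply: hat_tgt_adj.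
  have [u [su tu]] := hat_arrow_ex pq.
  by exists u; rewrite ?inE ?su // /hat_tgt tu.
move=> u v; rewrite !inE => /eqP su /eqP sv; apply: hat_ext.
by rewrite su sv.
Qed.

Lemma card_hat : #|hat G| = (3 * #|G|)%N.
Proof.
rewrite -sum1_card (partition_big (@hat_src G) xpredT) //=.
under eq_bigr => p _ do rewrite sum1dep_card card_hat_src.
by rewrite sum_nat_const mulnC.
Qed.

Lemma hat_cubic : cubic (hat G).
Proof.
move=> u; rewrite -(card_hat_src (hat_src u)).
(* Exchanging [u] for its reversal turns the triangle through [u] into the set of neighbours of
   [u]. *)
pose f v := if v == u then hat_flip u else v.
have -> : [set v | adj u v] = f @: [set v | hat_src v == hat_src u].
  apply/setP => v; rewrite inE cubic_hat_adjE; apply/idP/imsetP => [/orP[]|[w]].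
  - move=> /andP[s uv]; exists v; first by rewrite inE eq_sym.
    by rewrite /f eq_sym (negbTE uv).
  - move=> /eqP uv; exists u; rewrite ?inE //.
    by rewrite /f eqxx uv hat_flipK.
  - rewrite inE /f => s; case: (eqVneq w u) => [_ ->|wu ->].
      by rewrite hat_flipK eqxx orbT.
    by rewrite eq_sym s eq_sym wu.
apply: card_in_imset => v w; rewrite !inE /f => sv sw.
have fu x : hat_src x == hat_src u -> hat_flip u != x.
  by move=> sx; apply: contraNneq (hat_flip_neq u) => ->.
case: (eqVneq v u) => [->|_]; case: (eqVneq w u) => [->|_] // E.
- by have := fu _ sw; rewrite E eqxx.
- by have := fu _ sv; rewrite -E eqxx.
Qed.
End CubicHat.

Lemma card_complete (V : finType) : #|complete V| = #|V|.
Proof. by apply: (bij_eq_card (f := id : complete V -> V)); exists id. Qed.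

Lemma Gamma_cubic n : cubic (Gamma n).
Proof.
elim: n => [|n IH]; last exact: hat_cubic.
move=> p; transitivity #|[set~ (p : 'I_4)]|.
  by apply: eq_card => q; rewrite !inE eq_sym.
by rewrite cardsC1 card_ord.
Qed.

(** Stated as a double because half the number of points is the exponent in [char_poly_hat]. *)
Lemma card_Gamma n : #|Gamma n| = (2 * 3 ^ n).*2.
Proof.
elim: n => [|n IH]; first exact: card_ord.
by rewrite [LHS](card_hat (@Gamma_cubic n)) IH expnS; lia.
Qed.

(** * Immersions and coverings *)

Definition immersion (G H : graphType) (phi : G -> H) : Prop :=
  (forall p q, adj p q -> adj (phi p) (phi q)) /\
  (forall p q r, adj p q -> adj p r -> phi q = phi r -> q = r).

Lemma immersion_comp (G H K : graphType) (psi : H -> K) (phi : G -> H) :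
  immersion psi -> immersion phi -> immersion (psi \o phi).
Proof.
move=> [psiA psiI] [phiA phiI]; split=> [p q /phiA/psiA //|p q r pq pr e].
by apply: (phiI p) => //; apply: (psiI (phi p)) => //; apply: phiA.
Qed.

Lemma immersion_covering (G H : graphType) (phi : G -> H) :
  immersion phi ->
  (forall p s, adj (phi p) s -> exists q, adj p q /\ phi q = s) -> covering phi.
Proof.
move=> [phiA phiI] phiS p; split=> [q pq|q r|s /phiS[q [pq qs]]].
- exact: phiA.
- by move=> /classical_sets.set_mem pq /classical_sets.set_mem; apply: phiI pq.
- by exists q.
Qed.

Lemma covering_comp (G H K : graphType) (psi : H -> K) (phi : G -> H) :
  covering psi -> covering phi -> covering (psi \o phi).
Proof. by move=> psi_c phi_c p; apply: functions.set_bij_comp (psi_c (phi p)). Qed.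

(** * Extension of immersions to the hat *)

Section Immersions.
Variables G H : finGraphType.
Hypothesis H3 : cubic H.
Implicit Type phi : G -> H.

Lemma card_immersion phi p : immersion phi ->
  #|phi @: [set q | adj p q]| = #|[set q | adj p q]|.
Proof.
move=> [_ phiI]; apply: card_in_imset => q r.
by rewrite !inE => pq pr; apply: phiI pq pr.
Qed.

Lemma immersion_nbr_sub phi p : immersion phi ->
  phi @: [set q | adj p q] \subset [set s | adj (phi p) s].
Proof.
move=> [phiA _]; apply/subsetP => s /imsetP[q]; rewrite !inE => pq ->.
exact: phiA.
Qed.

(** At least three distinct images must exhaust the three neighbours of [phi p], so an immersion can
    fail to cover only at points of smaller valence. *)
Lemma immersion_nbr_surj phi p s : immersion phi ->
  2 < #|[set q | adj p q]| -> adj (phi p) s -> exists q, adj p q /\ phi q = s.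
Proof.
move=> phiL p3 ps.
have /eqP E : phi @: [set q | adj p q] == [set s | adj (phi p) s].
  by rewrite eqEcard immersion_nbr_sub // H3 card_immersion.
have : s \in phi @: [set q | adj p q] by rewrite E inE.
by case/imsetP => q; rewrite inE => pq ->; exists q.
Qed.

(* The neighbour of [phi p] missed by the two neighbours of the boundary
   point [p]. *)
Definition third phi p : H :=
  odflt (phi p) [pick s in [set s | adj (phi p) s] :\: phi @: [set q | adj p q]].

Lemma card_third phi p : immersion phi -> p \in boundary G ->
  #|[set s | adj (phi p) s] :\: phi @: [set q | adj p q]| = 1.
Proof.
move=> phiL; rewrite inE => /eqP p2.
by rewrite cardsD (setIidPr (immersion_nbr_sub _ phiL)) H3 card_immersion ?p2.
Qed.

Lemma third_in phi p : immersion phi -> p \in boundary G ->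
  third phi p \in [set s | adj (phi p) s] :\: phi @: [set q | adj p q].
Proof.
move=> phiL /(card_third phiL)/eqP/cards1P[s E].
by rewrite /third; case: pickP => //= /(_ s); rewrite E set11.
Qed.

Lemma third_adj phi p : immersion phi -> p \in boundary G ->
  adj (phi p) (third phi p).
Proof. by move=> phiL /(third_in phiL); rewrite !inE => /andP[]. Qed.

Lemma third_neq phi p q : immersion phi -> p \in boundary G -> adj p q ->
  phi q <> third phi p.
Proof.
move=> phiL /(third_in phiL) + pq e.
by rewrite -e inE imset_f // inE.
Qed.

Lemma third_eq phi p s : immersion phi -> p \in boundary G ->
  adj (phi p) s -> (forall q, adj p q -> phi q <> s) -> s = third phi p.
Proof.
move=> phiL bp ps qs; have /eqP/cards1P[t E] := card_third phiL bp.
have := third_in phiL bp; rewrite E => /set1P ->; apply/set1P.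
rewrite -E !inE ps andbT; apply/imsetP => -[q]; rewrite inE => pq e.
by apply: (qs q).
Qed.

(** A boundary point is treated as an arrow without target; its image points to the neighbour that
    [phi] misses. *)
Definition hat_map_tgt phi (u : hat G) : H :=
  if hat_dst u is Some q then phi q else third phi (hat_src u).

(* The point [x] is a junk value. *)
Definition hat_map (x : hat H) phi (u : hat G) : hat H :=
  arrow x (phi (hat_src u)) (hat_map_tgt phi u).

Lemma hat_map_adj phi u : immersion phi ->
  adj (phi (hat_src u)) (hat_map_tgt phi u).
Proof.
move=> phiL; rewrite /hat_map_tgt; case E : (hat_dst u) => [q|].
  by apply: phiL.1; apply: hat_dst_adj.
exact/third_adj/hat_dst_boundary.
Qed.

Lemma hat_map_src x phi u : immersion phi ->
  hat_src (hat_map x phi u) = phi (hat_src u).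
Proof. by move=> phiL; rewrite arrow_srcE // hat_map_adj. Qed.

Lemma hat_map_dst x phi u : immersion phi ->
  hat_dst (hat_map x phi u) = Some (hat_map_tgt phi u).
Proof. by move=> phiL; rewrite arrow_dstE // hat_map_adj. Qed.

Lemma hat_map_tgt_inj phi u v : immersion phi -> hat_src u = hat_src v ->
  hat_map_tgt phi u = hat_map_tgt phi v -> u = v.
Proof.
move=> phiL s; rewrite /hat_map_tgt s => e; apply: hat_inj => //.
move: e; case Eu : (hat_dst u) => [q|]; case Ev : (hat_dst v) => [r|] //.
- have uq := hat_dst_adj Eu; have vr := hat_dst_adj Ev; rewrite s in uq.
  by move/(phiL.2 _ _ _ uq vr) ->.
- have uq := hat_dst_adj Eu; rewrite s in uq.
  by move/third_neq => []//; apply: hat_dst_boundary.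
- have vr := hat_dst_adj Ev.
  by move/esym/third_neq => []//; rewrite -s; apply: hat_dst_boundary.
Qed.

Lemma hat_map_immersion x phi : immersion phi -> immersion (hat_map x phi).
Proof.
move=> phiL; split=> [u v|u v w].
  rewrite !hat_adjE !hat_map_dst // !hat_map_src // !(inj_eq Some_inj).
  case/orP => /andP[]; last first.
    by rewrite /hat_map_tgt => /eqP -> /eqP ->; rewrite !eqxx orbT.
  move=> /eqP s d; rewrite s eqxx /=; apply/orP; left.
  by apply: contraNneq d => /(hat_map_tgt_inj phiL s) ->.
move=> uv uw e; have {e} [s t] : phi (hat_src v) = phi (hat_src w) /\
    hat_map_tgt phi v = hat_map_tgt phi w.
  move: (congr1 (@hat_src H) e) (congr1 (@hat_dst H) e).
  by rewrite !hat_map_src // !hat_map_dst // => ? [].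
(* If one of [v], [w] shares the source of [u] and the other reverses [u], their sources are
   adjacent in [G], hence have distinct images, against [s]. *)
suff sE : hat_src v = hat_src w by apply: hat_map_tgt_inj t.
have irr p q : adj p q -> phi p <> phi q.
  by move=> /phiL.1 + pq; rewrite pq adj_irr.
move: uv uw; rewrite !hat_adjE.
case/orP => /andP[/eqP u1 /eqP v1]; case/orP => /andP[/eqP u2 /eqP w1].
- by rewrite -u1 -u2.
- by have /irr := hat_dst_adj u2; rewrite u1 s.
- by have /irr := hat_dst_adj u1; rewrite u2 s.
- by move: u1; rewrite u2 => -[].
Qed.
End Immersions.


Lemma hat_inhabited (H : finGraphType) : cubic H -> H -> inhabited (hat H).
Proof.
move=> H3 p; have /card_gt0P[q] : 0 < #|[set q | adj p q]| by rewrite H3.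
by rewrite inE => /hat_arrow_ex[u _].
Qed.

(** Arrows with the same source have distinct targets, and these are adjacent because the graph is
    complete. The neighbours of an arrow from [p] to [q] go to [p] and to the neighbours of [p]
    other than [q], all distinct. *)
Lemma hat_tgt_immersion (V : finType) : cubic (complete V) ->
  immersion (@hat_tgt (complete V) : hat _ -> complete V).
Proof.
move=> V3; split=> [u v|u v w]; rewrite !cubic_hat_adjE //.
  case/orP => [/andP[/eqP s uv]|/eqP ->]; last first.
    by rewrite hat_flip_tgt // hat_tgt_adj.
  change (hat_tgt u != hat_tgt v).
  by apply: contraNneq uv => /(hat_ext V3 s) ->.
have E (x y : hat (complete V)) : x = hat_flip y -> y = hat_flip x.
  by move=> ->; rewrite hat_flipK.
case/orP => [/andP[/eqP s1 _]|/eqP/E ->]; case/orP => [/andP[/eqP s2 _]|/eqP/E ->] //.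
- by apply: hat_ext; rewrite // -s1 -s2.
- rewrite hat_flip_tgt // s1 => e; have := hat_tgt_adj V3 v.
  by rewrite e adj_irr.
- rewrite hat_flip_tgt // s2 => e; have := hat_tgt_adj V3 w.
  by rewrite e adj_irr.
Qed.

Lemma Gamma_step n : exists phi : Gamma n.+1 -> Gamma n, immersion phi.
Proof.
elim: n => [|n [phi phiL]].
  by exists (@hat_tgt (Gamma 0)); apply/hat_tgt_immersion/(@Gamma_cubic 0).
have /card_gt0P[p _] : 0 < #|Gamma n.+1| by rewrite card_Gamma; lia.
have [x] := hat_inhabited (@Gamma_cubic n) (phi p).
by exists (hat_map x phi); apply/hat_map_immersion/phiL/Gamma_cubic.
Qed.

Lemma Gamma_covering m n : n <= m ->
  exists phi : Gamma m -> Gamma n, covering phi.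
Proof.
elim: m => [|m IH].
  by rewrite leqn0 => /eqP ->; exists id; apply: immersion_covering => // p s; exists s.
rewrite leq_eqVlt => /orP[/eqP <-|/IH[psi psi_c]].
  by exists id; apply: immersion_covering => // p s; exists s.
have [phi phiL] := Gamma_step m; exists (psi \o phi); apply: covering_comp psi_c _.
apply: immersion_covering => // p s; apply: immersion_nbr_surj => //.
  exact: Gamma_cubic.
by rewrite Gamma_cubic.
Qed.

(** * Subtriangles in terms of sources and targets *)

Section SubtriangleHat.
Variable n : nat.

Lemma hat_src_subtriangle i (u : triangle n.+1) :
  hat_src (subtriangle i u : hat (triangle n.+1)) = subtriangle i (hat_src u).
Proof.
have [sub_adj sub_corner _ _ sub_cross] := subtriangle_decomposition n.
case: u => [p|[[p q] /= pq]] /=; last by rewrite arrow_srcE // sub_adj.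
have [j pj] := (triangle_boundary n).2 _ (valP p).
rewrite pj cornerK; case: eqVneq => [->|ji]; first by rewrite sub_corner.
by rewrite arrow_srcE // sub_cross 1?eq_sym // !eqxx.
Qed.

Lemma hat_dst_subtriangle_arrow i (u : triangle n.+1) q :
  hat_dst u = Some q ->
  hat_dst (subtriangle i u : hat (triangle n.+1)) = Some (subtriangle i q).
Proof.
have [sub_adj _ _ _ _] := subtriangle_decomposition n.
by case: u => // -[[p r] /= pr] [<-]; rewrite arrow_dstE // sub_adj.
Qed.

(** A corner [j] other than [i] leaves the boundary: it becomes the arrow along the edge joining the
    subtriangles at [i] and [j]. *)
Lemma hat_dst_subtriangle_corner i j :
  hat_dst (subtriangle i (corner n.+1 j) : hat (triangle n.+1)) =
  if j == i then None else Some (subtriangle j (corner n i)).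
Proof.
have [_ _ _ _ sub_cross] := subtriangle_decomposition n.
rewrite /= -/(corner n j) cornerK; case: eqVneq => // ji.
by rewrite arrow_dstE // sub_cross 1?eq_sym // !eqxx.
Qed.

Lemma hat_dst_None (u : triangle n.+1) :
  hat_dst u = None -> exists i, u = corner n.+1 i.
Proof.
case: u => // p _; have [i pi] := (triangle_boundary n).2 _ (valP p).
by exists i; rewrite /corner /=; congr inl; apply: val_inj.
Qed.
End SubtriangleHat.

Lemma corner_boundary n i : corner n i \in boundary (triangle n).
Proof. exact: valP. Qed.

Lemma subtriangle0_immersion n : immersion (@subtriangle n ord0).
Proof.
split=> [p q|p q r _ _ /subtriangle0_inj //].
by rewrite subtriangle0_adj.
Qed.

Lemma subtriangle0_corner n : subtriangle ord0 (corner n ord0) = corner n.+1 ord0.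
Proof. by have [_ h _ _ _] := subtriangle_decomposition n. Qed.

Lemma adj_corner n (q : triangle n.+1) :
  adj (corner n.+1 ord0) q -> hat_src q = corner n ord0.
Proof. by rewrite hat_adjE => /orP[/andP[/eqP <-]|/andP[]]. Qed.

Lemma hat_map_subtriangle (H : finGraphType) (x : hat H) n
    (phi : triangle n -> H) (psi : triangle n.+1 -> H) (u : triangle n.+1) :
  cubic H -> immersion phi -> immersion psi ->
  (forall p, psi (subtriangle ord0 p) = phi p) ->
  hat_map x psi (subtriangle ord0 u) = hat_map x phi u.
Proof.
move=> H3 phiL psiL sub_psi.
have [sub_adj sub_corner _ sub_inj sub_cross] := subtriangle_decomposition n.
rewrite /hat_map hat_src_subtriangle sub_psi; congr (arrow _ _ _).
rewrite /hat_map_tgt; case E : (hat_dst u) => [q|].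
  by rewrite (hat_dst_subtriangle_arrow _ E).
have [j ->] := hat_dst_None E; rewrite hat_dst_subtriangle_corner.
rewrite hat_src_subtriangle [hat_src _]/= -/(corner n j).
(* The corner [ord0] stays on the boundary with the same neighbours, so [psi] and [phi] miss the
   same point there. *)
case: eqVneq => [->|j0].
  rewrite sub_corner; apply: third_eq => //; first exact: corner_boundary.
    by rewrite -sub_psi sub_corner third_adj // corner_boundary.
  move=> q; rewrite -(sub_adj ord0) sub_corner -sub_psi => aq.
  by apply: third_neq aq => //; apply: corner_boundary.
(* Any other corner acquires a third neighbour, across this edge; by local injectivity [psi] sends
   it to the point missed by [phi]. *)
have cross : adj (subtriangle ord0 (corner n j)) (subtriangle j (corner n ord0)).
  by rewrite sub_cross 1?eq_sym // !eqxx.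
apply: third_eq => //; first exact: corner_boundary.
  by rewrite -sub_psi; apply: psiL.1.
move=> q; rewrite -(sub_adj ord0) -sub_psi => aq.
move/(psiL.2 _ _ _ aq cross)/sub_inj => [e _].
by rewrite e eqxx in j0.
Qed.

(* Compatible immersions of the finite triangles exhausting the two halves of
   the Pascal graph, the last condition accounting for the edge between their
   apices. *)
Definition pascal_family (H : finGraphType)
    (phi : bool -> forall n, triangle n -> H) : Prop :=
  [/\ forall b n, immersion (phi b n),
      forall b n p, phi b n.+1 (subtriangle ord0 p) = phi b n p &
      forall b n, phi (~~ b) n (corner n ord0) = third (phi b n) (corner n ord0)].

Lemma pascal_family_hat (H : finGraphType) phi : cubic H ->
  @pascal_family H phi -> exists psi, @pascal_family (hat H) psi.
Proof.
move=> H3 [phiL phiS phiT].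
have [x] := hat_inhabited H3 (phi true 0 (corner 0 ord0)).
(* The extension of [phi b n] lives on [triangle n.+1]; restricting it to the subtriangle at the
   apex gives a family indexed from stage 0 again. *)
pose psi b n (p : triangle n) : hat H :=
  hat_map x (phi b n) (subtriangle ord0 p : hat (triangle n)).
have psiL b n : immersion (psi b n).
  apply: (@immersion_comp _ (hat (triangle n)) _ (hat_map x (phi b n))).
    exact: hat_map_immersion.
  exact: subtriangle0_immersion.
exists psi; split=> [//|b n p|b n].
  by apply: hat_map_subtriangle => // q; rewrite phiS.
(* The apices of the two halves go to an arrow and its reversal, hence to adjacent points of
   [hat H]. *)
have psi_corner c : hat_src (psi c n (corner n ord0)) = phi c n (corner n ord0) /\
    hat_dst (psi c n (corner n ord0)) = Some (phi (~~ c) n (corner n ord0)).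
  by rewrite /psi subtriangle0_corner hat_map_src // hat_map_dst // phiT.
have [s1 t1] := psi_corner b; have [] := psi_corner (~~ b); rewrite negbK => s2 t2.
apply: third_eq => //; [exact: hat_cubic|exact: corner_boundary| |].
  by rewrite hat_adjE s1 t1 s2 t2 !eqxx orbT.
(* Within its own half, the neighbours of the apex map to arrows with the same source as the image
   of the apex, never to the reversal. *)
move=> q; rewrite -subtriangle0_adj subtriangle0_corner => /adj_corner sq.
move/(congr1 (@hat_src H)); rewrite s2 /psi hat_map_src // sq.
move=> e; have := third_adj H3 (phiL b n) (corner_boundary n ord0).
by rewrite -phiT e adj_irr.
Qed.

Lemma pascal_family_Gamma0 : exists phi, @pascal_family (Gamma 0) phi.
Proof.
have G3 := @Gamma_cubic 0.
have [x] := hat_inhabited G3 (ord0 : Gamma 0).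
pose sw (c : Gamma 0) : Gamma 0 := tperm (ord0 : 'I_4) (ord_max : 'I_4) c.
have swK : involutive sw by move=> c; apply: tpermK.
have adjE (c d : Gamma 0) : adj c d = (c != d) by [].
have swL : immersion sw.
  split=> [c d|c d e _ _]; last exact: (can_inj swK).
  by rewrite !adjE (can_eq swK).
pose f := fix f n : triangle n -> Gamma 0 :=
  if n is n'.+1 then fun u => sw (hat_tgt (hat_map x (f n') u))
  else fun i : 'I_3 => widen_ord (isT : 3 <= 4) i : 'I_4.
have f0E (i : triangle 0) : val (f 0 i : 'I_4) = val (i : 'I_3) by [].
have fL n : immersion (f n).
  elim: n => [|n IH].
    split=> [i j|i j k _ _ e]; last by apply: (@ord_inj 3); rewrite -f0E e.
    by apply: contraNneq => e; apply/eqP/(@ord_inj 3); rewrite -f0E e.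
  apply: (immersion_comp swL).
  exact: immersion_comp (hat_tgt_immersion G3) (hat_map_immersion G3 x IH).
have fSE n u : f n.+1 u = sw (hat_map_tgt (f n) u).
  by rewrite /= /hat_tgt hat_map_dst.
(* The base triangle has colours 0, 1, 2, so its apex misses colour 3. *)
have f0T : third (f 0) (corner 0 ord0) = ord_max :> 'I_4.
  symmetry; apply: (third_eq G3 (fL 0)) => //; first exact: corner_boundary.
  move=> i _ /(congr1 (val : 'I_4 -> nat)); rewrite f0E => e.
  by move: (ltn_ord (i : 'I_3)); rewrite e.
have fS n p : f n.+1 (subtriangle ord0 p) = f n p.
  elim: n p => [|n IH] p; last first.
    by congr (sw (hat_tgt _)); apply: hat_map_subtriangle.
  (* The apex has target colour 3, which [sw] brings back to 0. Another point [p] becomes the arrow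
     from the apex to [p], with target colour 1 or 2, fixed by [sw]. *)
  rewrite fSE; have [p0|p0] := eqVneq (p : 'I_3) ord0.
    rewrite p0 (subtriangle0_corner 0) [hat_map_tgt _ _]f0T.
    by rewrite /sw tpermR; apply: val_inj.
  have ap : adj (ord0 : triangle 0) p by rewrite adj_sym; exact: p0.
  rewrite /= (negbTE p0) /hat_map_tgt arrow_dstE //.
  by rewrite /sw tpermD //; rewrite -val_eqE eq_sym /= ?neq_ltn ?(ltn_ord (p : 'I_3)) ?orbT.
have f_corner n : f n (corner n ord0) = ord0 :> 'I_4.
  elim: n => [|n IH]; first exact: val_inj.
  by rewrite -subtriangle0_corner fS.
have f_neq n q : adj (corner n ord0) q -> f n q <> ord_max :> 'I_4.
  case: n q => [|n] q.
    rewrite -f0T; apply: (third_neq G3 (fL 0)); exact: corner_boundary.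
  rewrite hat_adjE => /orP[/andP[/eqP s d]|/andP[]//].
  rewrite fSE /hat_map_tgt -s; case E : (hat_dst q) d => [r|] // _ e.
  have := (fL n).1 _ _ (hat_dst_adj E); rewrite -s [hat_src _]/= -/(corner n ord0).
  by rewrite f_corner adjE -(inj_eq (can_inj swK)) e /sw tpermL eqxx.
(* The apices get colours 3 and 0, each being the colour missing around the other apex. *)
exists (fun b n => if b then sw \o f n else f n); split.
- by move=> [] n //; apply: immersion_comp.
- by move=> [] n p; [apply: (congr1 sw)|]; apply: fS.
- move=> [] n; apply: third_eq; rewrite //= ?corner_boundary ?f_corner ?/sw ?tpermL //.
  + exact: immersion_comp.
  + move=> q /f_neq h e; apply: h.
    by rewrite -[f n q]swK [sw (f n q)]e /sw tpermL.
  + exact: f_neq.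
Qed.

Lemma pascal_family_Gamma n : exists phi, @pascal_family (Gamma n) phi.
Proof.
elim: n => [|n [phi phiP]]; first exact: pascal_family_Gamma0.
exact: pascal_family_hat (@Gamma_cubic n) phiP.
Qed.

(** * Adjacency in an increasing union and maps out of it *)

Section UnionGraph.
Variable T : tower.

Lemma in_union_raise m n : m <= n -> exists f : stage T m -> stage T n,
  (forall p, in_union (f p) = in_union p) /\
  (forall p q, adj (f p) (f q) = adj p q).
Proof.
elim: n => [|n IH]; first by rewrite leqn0 => /eqP ->; exists id.
rewrite leq_eqVlt => /orP[/eqP ->|/IH[f [fU fA]]]; first by exists id.
exists (fun p => incl (f p)).
by split=> [p|p q]; rewrite ?in_union_incl ?incl_adj.
Qed.

Lemma in_union_adj n (p q : stage T n) :
  adj (in_union p : union T) (in_union q : union T) = adj p q.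
Proof.
apply/boolp.asboolP/idP => [[m [r [s [pr qs rs]]]]|pq]; last by exists n, p, q.
have [f [fU fA]] := in_union_raise (leq_maxl m n).
have [g [gU gA]] := in_union_raise (leq_maxr m n).
rewrite -gA; have /in_union_inj -> : in_union (g p) = in_union (f r) by rewrite gU fU.
have /in_union_inj -> : in_union (g q) = in_union (f s) by rewrite gU fU.
by rewrite fA.
Qed.

Lemma union_stage2 (u v : union T) : exists n (p q : stage T n),
  u = in_union p /\ v = in_union q.
Proof.
have [m [p ->]] := in_union_surj u; have [n [q ->]] := in_union_surj v.
have [f [fU _]] := in_union_raise (leq_maxl m n).
have [g [gU _]] := in_union_raise (leq_maxr m n).
by exists (maxn m n), (f p), (g q); rewrite fU gU.
Qed.

Lemma union_stage3 (u v w : union T) : exists n (p q r : stage T n),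
  [/\ u = in_union p, v = in_union q & w = in_union r].
Proof.
have [m [p [q [-> ->]]]] := union_stage2 u v; have [n [r ->]] := in_union_surj w.
have [f [fU _]] := in_union_raise (leq_maxl m n).
have [g [gU _]] := in_union_raise (leq_maxr m n).
by exists (maxn m n), (f p), (f q), (g r); rewrite !fU gU.
Qed.

Section UnionMap.
Variables (H : Type) (phi : forall n, stage T n -> H).
Hypothesis phi_incl : forall n p, phi (@incl T n p) = phi p.

(** Read at a chosen representative; [phi_incl] makes the value constant on classes, since
    identified points agree after finitely many shifts. *)
Definition union_map (u : union T) : H :=
  let x := generic_quotient.repr (u : {eq_quot (@identified T)}%qT) in
  phi (tagged x).

Lemma union_mapE n (p : stage T n) : union_map (in_union p) = phi p.
Proof.
have phi_iter k x : phi (tagged (iter k (@shift T) x)) = phi (tagged x).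
  by elim: k => //= k IH; rewrite phi_incl.
rewrite /union_map; set x := generic_quotient.repr _.
have /generic_quotient.eqmodP/boolp.asboolP[i [j e]] :
    (x = existT _ n p %[mod {eq_quot (@identified T)}])%qT.
  by rewrite generic_quotient.reprK.
by rewrite -(phi_iter i) e phi_iter.
Qed.
End UnionMap.
End UnionGraph.

Lemma apexE n : apex = @in_union triangle_tower n (corner n ord0).
Proof.
elim: n => [//|n ->].
by rewrite -(@in_union_incl triangle_tower) /= subtriangle0_corner.
Qed.

(** One stage further, a point lies in the subtriangle at [ord0], whose only boundary point in the
    larger triangle is the apex. *)
Lemma infinite_triangle_stage (u : infinite_triangle) :
  u = apex \/ exists n (p : triangle n),
    u = @in_union triangle_tower n p /\ 2 < #|[set q | adj p q]|.
Proof.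
have [n [p ->]] := @in_union_surj triangle_tower u.
have [_ _ _ sub_inj _] := subtriangle_decomposition n.
rewrite -(@in_union_incl triangle_tower); set q := incl p.
have [bq|bq] := boolP (q \in boundary (triangle n.+1)).
  have [i qi] := (triangle_boundary n.+1).2 _ bq.
  left; rewrite (apexE n.+1) qi; congr (@in_union triangle_tower _ (corner _ _)).
  have [_ sub_corner _ _ _] := subtriangle_decomposition n.
  by move: qi; rewrite -sub_corner => /sub_inj[].
right; exists n.+1, q; split=> //; move: bq.
have := (triangle_boundary n.+1).1 q; rewrite inE.
by case: #|_| => [|[|[|]]].
Qed.

Lemma pascal_family_covering (H : finGraphType) phi : cubic H ->
  @pascal_family H phi -> exists psi : pascal -> H, covering psi.
Proof.
move=> H3 [phiL phiS phiT].
pose pt b (u : infinite_triangle) : pascal := if b then inr u else inl u.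
have ptP x : exists b u, x = pt b u.
  by case: x => u; [exists false, u|exists true, u].
have adj_pt b c u v : adj (pt b u) (pt c v) =
    if b == c then adj u v else (u == apex) && (v == apex).
  by case: b; case: c.
pose T := triangle_tower; pose F b := @union_map T _ (phi b).
have FE b n (p : triangle n) : F b (@in_union T n p) = phi b n p.
  by apply: union_mapE => m q; apply: phiS.
pose psi (x : pascal) := match x with inl u => F false u | inr u => F true u end.
have psi_pt b u : psi (pt b u) = F b u by case: b.
have bd n := corner_boundary n ord0.
have F_apex b : F (~~ b) apex = third (phi b 0) (corner 0 ord0).
  by rewrite (apexE 0) FE phiT.
have cross b v : adj (apex : infinite_triangle) v -> F b v <> F (~~ b) apex.
  have [n [p [q [pE ->]]]] := @union_stage2 T apex v.
  rewrite (apexE n) !FE in_union_adj phiT => aq.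
  exact: (third_neq H3 (phiL b n) (bd n) aq).
have neqE (b c : bool) : (b == c) = false -> c = ~~ b by case: b; case: c.
exists psi; apply: immersion_covering; first split.
- move=> x y; have [b [u ->]] := ptP x; have [c [v ->]] := ptP y.
  rewrite adj_pt !psi_pt; case: eqP => [<-|/eqP/negbTE/neqE ->].
    have [n [p [q [-> ->]]]] := @union_stage2 T u v.
    by rewrite !FE in_union_adj; apply: (phiL b n).1.
  by case/andP => /eqP -> /eqP ->; rewrite F_apex (apexE 0) FE; apply: third_adj (bd 0).
- move=> x y z; have [b [u ->]] := ptP x; have [c [v ->]] := ptP y.
  have [d [w ->]] := ptP z; rewrite !adj_pt !psi_pt.
  case: (eqVneq b c) => [<-|/negbTE/neqE ->];
    case: (eqVneq b d) => [<-|/negbTE/neqE ->].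
  + have [n [p [q [r [-> -> ->]]]]] := @union_stage3 T u v w.
    by rewrite !FE !in_union_adj => pq pr e; rewrite ((phiL b n).2 _ _ _ pq pr e).
  + by move=> uv /andP[/eqP uE /eqP ->] /cross []; rewrite -uE.
  + by move=> /andP[/eqP uE /eqP ->] uw /esym/cross []; rewrite -uE.
  + by move=> /andP[_ /eqP ->] /andP[_ /eqP ->].
move=> x s; have [b [u ->]] := ptP x; rewrite psi_pt.
have [->|[n [p [-> p3]]]] := infinite_triangle_stage u.
  rewrite (apexE 0) FE => as_.
  (* At the apex, [s] is the colour of a neighbour in the same half or else the missed colour, taken
     by the opposite apex. *)
  have [|h] := boolP [exists q, adj (corner 0 ord0) q && (phi b 0 q == s)].
    case/existsP => q /andP[aq /eqP <-]; exists (pt b (@in_union T 0 q)).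
    by rewrite adj_pt eqxx psi_pt FE in_union_adj.
  exists (pt (~~ b) apex); rewrite adj_pt psi_pt F_apex -(apexE 0) !eqxx.
  split; first by case: b {as_ h}.
  symmetry; apply: (third_eq H3 (phiL b 0) (bd 0)) => // q aq e; case/existsP: h.
  by exists q; rewrite aq e eqxx.
rewrite FE => /(immersion_nbr_surj H3 (phiL b n) p3)[q [pq <-]].
by exists (pt b (@in_union T n q)); rewrite adj_pt eqxx psi_pt FE in_union_adj.
Qed.

Lemma pascal_covering n : exists psi : pascal -> Gamma n, covering psi.
Proof.
have [phi phiP] := pascal_family_Gamma n.
exact: pascal_family_covering (@Gamma_cubic n) phiP.
Qed.

(** * Characteristic polynomials *)

Local Open Scope ring_scope.

(** The sizes are kept apart because the dimension of a space and the number of coordinates are only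
    provably equal. *)
Lemma char_poly_conj (F : fieldType) m n (A : 'M[F]_n) (P : 'M_(m, n))
    (Q : 'M_(n, m)) :
  P *m Q = 1%:M -> Q *m P = 1%:M -> char_poly (P *m A *m Q) = char_poly A.
Proof.
move=> PQ QP; have mn : m = n.
  apply/eqP; rewrite eqn_leq -{1}(mxrank1 F m) -{2}(mxrank1 F n) -PQ -QP.
  by rewrite !(leq_trans (mxrankM_maxr _ _)) ?rank_leq_row.
case: n / mn A P Q PQ QP => A P Q PQ QP.
pose P' := map_mx polyC P; pose Q' := map_mx polyC Q.
have QP' : \det Q' * \det P' = 1 by rewrite -det_mulmx -map_mxM QP map_mx1 det1.
have E : char_poly_mx (P *m A *m Q) = P' *m char_poly_mx A *m Q'.
  rewrite /char_poly_mx mulmxBr mulmxBl -!map_mxM; congr (_ - _).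
  by rewrite scalar_mxC -mulmxA -map_mxM PQ map_mx1 mulmx1.
by rewrite /char_poly E !det_mulmx mulrC mulrA QP' mul1r.
Qed.

Lemma char_poly_end_coord (F : fieldType) (V : vectType F) (f : 'End(V)) n
    (g : {linear V -> 'rV[F]_n}) (h : {linear 'rV[F]_n -> V}) (A : 'M_n) :
  cancel g h -> cancel h g -> (forall v, g (f v) = g v *m A) ->
  char_poly_end f = char_poly A.
Proof.
move=> gK hK gf; pose e := vbasis {:V}.
have eb : basis_of {:V} e := vbasisP _.
pose P := lin1_mx (g \o passmx.vecof e).
pose Q := lin1_mx (passmx.rVof e \o h).
have PE u : u *m P = g (passmx.vecof e u) by rewrite mul_rV_lin1.
have QE u : u *m Q = passmx.rVof e (h u) by rewrite mul_rV_lin1.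
rewrite /char_poly_end -(@char_poly_conj _ _ _ A P Q).
- congr char_poly; apply/row_matrixP => i; rewrite !rowE passmx.mul_mxof.
  by rewrite !mulmxA PE -gf QE gK.
- apply/row_matrixP => i; rewrite !rowE mulmxA PE QE gK passmx.vecofK //.
  by rewrite mulmx1.
- by apply/row_matrixP => i; rewrite !rowE mulmxA QE PE passmx.rVofK // hK mulmx1.
Qed.

Section FinMatrix.
Variable R : pzSemiRingType.
Implicit Types G H K : finType.

Definition fin_mx G H (F : G -> H -> R) : 'M[R]_(#|G|, #|H|) :=
  \matrix_(i, j) F (enum_val i) (enum_val j).

Lemma eq_fin_mx G H (E F : G -> H -> R) :
  (forall p q, E p q = F p q) -> fin_mx E = fin_mx F.
Proof. by move=> EF; apply/matrixP => i j; rewrite !mxE EF. Qed.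

Lemma mul_fin_mx G H K (E : G -> H -> R) (F : H -> K -> R) :
  fin_mx E *m fin_mx F = fin_mx (fun p r => \sum_q E p q * F q r).
Proof.
apply/matrixP => i k; rewrite !mxE (reindex _ (onW_bij _ (@enum_val_bij H))).
by apply: eq_bigr => j _; rewrite !mxE.
Qed.

Lemma fin_mx_scalar G (a : R) : fin_mx (fun p q : G => a *+ (p == q)) = a%:M.
Proof. by apply/matrixP => i j; rewrite !mxE (inj_eq enum_val_inj). Qed.

Lemma tr_fin_mx G H (F : G -> H -> R) :
  (fin_mx F)^T = fin_mx (fun q p => F p q).
Proof. by apply/matrixP => i j; rewrite !mxE. Qed.
End FinMatrix.

Definition adj_mx (R : pzSemiRingType) (G : finGraphType) : 'M[R]_#|G| :=
  fin_mx (fun p q : G => (adj p q)%:R).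

Lemma map_adj_mx (F : nzRingType) (G : finGraphType) :
  map_mx polyC (adj_mx F G) = adj_mx {poly F} G.
Proof. by apply/matrixP => i j; rewrite !mxE /= polyC_natr. Qed.

Lemma char_poly_Delta (R : realType) (G : finGraphType) :
  char_poly_end (Delta R G) = char_poly (adj_mx R[i] G).
Proof.
pose g (phi : {ffun G -> R[i]^o}) : 'rV[R[i]]_#|G| := \row_i phi (enum_val i).
pose h (v : 'rV[R[i]]_#|G|) : {ffun G -> R[i]^o} := [ffun p => v 0 (enum_rank p)].
have g_lin : linear g by move=> a u v; apply/rowP => i; rewrite !mxE !ffunE.
have h_lin : linear h by move=> a u v; apply/ffunP => p; rewrite !ffunE !mxE.
pose gL := GRing.isLinear.Build _ _ _ _ g g_lin.
pose hL := GRing.isLinear.Build _ _ _ _ h h_lin.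
pose g' : {linear {ffun G -> R[i]^o} -> 'rV[R[i]]_#|G|} := HB.pack g gL.
pose h' : {linear 'rV[R[i]]_#|G| -> {ffun G -> R[i]^o}} := HB.pack h hL.
apply: (@char_poly_end_coord _ _ _ _ g' h').
- by move=> phi; apply/ffunP => p; rewrite /= ffunE mxE enum_rankK.
- by move=> v; apply/rowP => i; rewrite /= mxE ffunE enum_valK.
move=> phi; apply/rowP => j; rewrite /= !mxE lfunE /= ffunE.
rewrite big_mkcond (reindex _ (onW_bij _ (@enum_val_bij G))) /=.
(* Matrices act on row vectors, which transposes the operator; adjacency is symmetric. *)
apply: eq_bigr => i _; rewrite !mxE adj_sym.
by case: ifP; rewrite ?mulr1 ?mulr0.
Qed.

(** * Incidence and reversal matrices of the arrows *)

Section Spectrum.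
Variables (F : comPzRingType) (G : finGraphType).
Hypothesis G3 : cubic G.

Definition src_mx : 'M[F]_(#|G|, #|hat G|) :=
  fin_mx (fun (p : G) (u : hat G) => (hat_src u == p)%:R).

Definition flip_mx : 'M[F]_#|hat G| :=
  fin_mx (fun u v : hat G => (u == hat_flip v)%:R).

Lemma flip_mxK : flip_mx *m flip_mx = 1%:M.
Proof.
rewrite mul_fin_mx -[RHS]fin_mx_scalar; apply: eq_fin_mx => u v.
rewrite (bigD1 (hat_flip v)) //= eqxx mulr1 hat_flipK // big1 ?addr0 //.
by move=> w /negbTE ->; rewrite mulr0.
Qed.

Lemma src_mxK : src_mx *m src_mx^T = 3%:M.
Proof.
rewrite tr_fin_mx mul_fin_mx -[RHS]fin_mx_scalar; apply: eq_fin_mx => p q.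
have [->|pq] := eqVneq p q.
  rewrite mulr1n.
  have -> : 3 = #|[set u : hat G | hat_src u == q]|%:R :> F by rewrite card_hat_src.
  rewrite -sum1dep_card natr_sum [RHS]big_mkcond.
  by apply: eq_bigr => u _; case: ifP; rewrite ?mulr1 ?mulr0.
rewrite big1 // => u _; case: eqP => [->|_]; last by rewrite mul0r.
by rewrite (negbTE pq) mulr0.
Qed.

Lemma src_flip_mx : src_mx *m flip_mx *m src_mx^T = adj_mx F G.
Proof.
rewrite tr_fin_mx !mul_fin_mx; apply: eq_fin_mx => p q.
transitivity (\sum_(v : hat G) ((hat_tgt v == p) && (hat_src v == q))%:R : F).
  apply: eq_bigr => v _; rewrite (bigD1 (hat_flip v)) //= eqxx mulr1 big1.
    by rewrite addr0 hat_flip_src // -natrM mulnb.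
  by move=> u /negbTE ->; rewrite mulr0.
have [qp|qp] := boolP (adj q p).
  have [u [su tu]] := hat_arrow_ex qp; rewrite adj_sym qp (bigD1 u) //=.
  rewrite /hat_tgt tu su !eqxx big1 ?addr0 // => v vu.
  case: andP => // -[/eqP tv /eqP sv]; case/eqP: vu.
  by apply: hat_ext; rewrite ?sv ?su // /hat_tgt tv tu.
rewrite adj_sym (negbTE qp) big1 // => v _; case: andP => // -[/eqP tv /eqP sv].
by case/negP: qp; rewrite -tv -sv hat_tgt_adj.
Qed.

(** The two cases of [cubic_hat_adjE] exclude each other, since reversal changes the source, so
    their matrices add. *)
Lemma adj_mx_hat : adj_mx F (hat G) = src_mx^T *m src_mx - 1%:M + flip_mx.
Proof.
rewrite tr_fin_mx mul_fin_mx -[1%:M]fin_mx_scalar; apply/matrixP => i j; rewrite !mxE.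
set u := enum_val i; set v := enum_val j.
rewrite (bigD1 (hat_src v)) //= big1 => [|q /negbTE]; last first.
  by rewrite [q == _]eq_sym => ->; rewrite mulr0.
rewrite eqxx mulr1 addr0 cubic_hat_adjE //.
have [uv|uv] := eqVneq u (hat_flip v).
  have /negbTE su : hat_src u != hat_src v by rewrite uv hat_flip_neq.
  have /negbTE -> : u != v by apply: contraFneq su => ->.
  by rewrite su orbT subr0 add0r.
rewrite orbF addr0; have [<-|_] := eqVneq u v; first by rewrite eqxx subrr.
by rewrite andbT subr0.
Qed.
End Spectrum.

Lemma det_sub_mulmx (K : comNzRingType) m n (M : 'M[K]_m) (U : 'M_(m, n))
    (V : 'M_(n, m)) :
  \det (M - U *m V) = \det (block_mx M U V 1%:M).
Proof.
have -> : block_mx M U V 1%:M =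
    block_mx (M - U *m V) U 0 1%:M *m block_mx 1%:M 0 V 1%:M.
  rewrite mulmx_block !mulmx1 !mul1mx !mulmx0 !add0r.
  by rewrite subrK.
by rewrite det_mulmx det_ublock det_lblock !det1 !mulr1.
Qed.

(* The Schur complement of [M], with the adjugate-like [M'] replacing the
   inverse so that no division occurs. *)
Lemma det_sub_mulmx_scaled (K : comNzRingType) m n (M M' : 'M[K]_m)
    (U : 'M_(m, n)) (V : 'M_(n, m)) (c : K) :
  M *m M' = c%:M ->
  \det (M - U *m V) * (\det M' * c ^+ n) =
  c ^+ m * \det (c%:M - V *m M' *m U).
Proof.
move=> MM'; rewrite det_sub_mulmx -[c ^+ n]det_scalar.
(* Multiplication by this upper triangular block matrix clears the upper right block. *)
rewrite -(det_ublock M' (- (M' *m U))) -det_mulmx mulmx_block.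
rewrite !mulmx0 !addr0 mul1mx !mulmxN mulmxA MM' mul_scalar_mx.
rewrite mul_mx_scalar addNr det_lblock det_scalar.
by rewrite addrC mulmxA.
Qed.

Section HatCharPoly.
Variables (F : numFieldType) (G : finGraphType) (k : nat).
Hypothesis G3 : cubic G.
Hypothesis Gk : #|G| = k.*2.

Local Notation c := ('X * ('X + 2%:P) : {poly F}).
Local Notation T := (flip_mx {poly F} G).

Lemma flip_mx_quadratic :
  (('X + 1)%:M - T) *m (('X + 1)%:M + T) = c%:M.
Proof.
rewrite mulmxBl !mulmxDr flip_mxK // -scalar_mxM scalar_mxC.
rewrite opprD addrA addrK -raddfB; congr (_%:M).
by rewrite polyC_natr; ring.
Qed.

(** Orient each edge by the ranks of its ends. Reversal changes the sign [sgn], so conjugation by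
    the diagonal sign matrix [D] turns [T] into its opposite. *)
Lemma det_flip_mx_opp : \det (('X + 1)%:M - T) = \det (('X + 1)%:M + T).
Proof.
pose sgn (u : hat G) := (enum_rank (hat_src u) < enum_rank (hat_tgt u))%N.
have sgnF u : sgn (hat_flip u) = ~~ sgn u.
  rewrite /sgn hat_flip_src // hat_flip_tgt // -leqNgt [RHS]leq_eqVlt.
  case: eqP => [/ord_inj/enum_rank_inj e|_]; last by [].
  by have := hat_tgt_adj G3 u; rewrite e adj_irr.
pose D : 'M[{poly F}]_#|hat G| :=
  fin_mx (fun u v : hat G => (-1) ^+ sgn u *+ (u == v)).
have DD : D *m D = 1%:M.
  rewrite mul_fin_mx -[RHS]fin_mx_scalar; apply: eq_fin_mx => u v.
  rewrite (bigD1 u) //= eqxx big1 ?addr0 => [|w /negbTE]; last first.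
    by rewrite eq_sym => ->; rewrite mul0r.
  by rewrite mulrnAr -signr_addb addbb.
have DTD : D *m T *m D = - T.
  have -> : D *m T = fin_mx (fun u v : hat G => (-1) ^+ sgn u *+ (u == hat_flip v)).
    rewrite mul_fin_mx; apply: eq_fin_mx => u v.
    rewrite (bigD1 u) //= eqxx big1 => [|w /negbTE]; last first.
      by rewrite eq_sym => ->; rewrite mul0r.
    by rewrite addr0 mulr_natr.
  rewrite mul_fin_mx; apply/matrixP => i j; rewrite !mxE.
  set u := enum_val i; set v := enum_val j.
  rewrite (bigD1 v) //= eqxx big1 => [|w /negbTE ->]; last by rewrite mulr0.
  rewrite addr0; case: eqP => [->|_]; last by rewrite mul0r oppr0.
  by rewrite sgnF -signr_addb addNb addbb.
have -> : ('X + 1)%:M - T = D *m (('X + 1)%:M + T) *m D.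
  by rewrite mulmxDr mulmxDl DTD scalar_mxC -mulmxA DD mulmx1.
by rewrite !det_mulmx mulrAC -det_mulmx DD det1 mul1r.
Qed.

(** [flip_mx_quadratic] and [det_flip_mx_opp] give the square of the determinant; both sides being
    monic fixes the sign. *)
Lemma det_flip_mx : \det (('X + 1)%:M + T) = c ^+ (3 * k).
Proof.
have d_monic : \det (('X + 1)%:M + T) \is monic.
  suff -> : ('X + 1)%:M + T = char_poly_mx (- (1%:M + flip_mx F G)).
    exact: char_poly_monic.
  rewrite /char_poly_mx map_mxN opprK map_mxD map_mx1 raddfD addrA.
  by congr (_ + _ + _); apply/matrixP => i j; rewrite !mxE /= polyC_natr.
have c_monic : c ^+ (3 * k) \is monic.
  by rewrite monic_exp // monicMr ?monicX // -[2%:P]opprK -polyCN monicXsubC.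
have /eqP : \det (('X + 1)%:M + T) ^+ 2 = (c ^+ (3 * k)) ^+ 2.
  rewrite expr2 -{1}det_flip_mx_opp -det_mulmx flip_mx_quadratic det_scalar.
  by rewrite card_hat // Gk -exprM -muln2 mulnA.
rewrite eqf_sqr => /orP[/eqP //|/eqP e].
move: d_monic; rewrite e monicE lead_coefN (monicP c_monic).
by rewrite eqNr oner_eq0.
Qed.

Lemma char_poly_hat :
  char_poly (adj_mx F (hat G)) =
  c ^+ k * (char_poly (adj_mx F G) \Po ('X ^+ 2 - 'X - 3%:P)).
Proof.
have c_neq0 : c != 0.
  by rewrite mulf_neq0 ?polyX_eq0 // -[2%:P]opprK -polyCN polyXsubC_eq0.
pose S := src_mx {poly F} G.
have := det_sub_mulmx_scaled S^T S flip_mx_quadratic.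
rewrite det_flip_mx -exprD.
have -> : ('X + 1)%:M - T - S^T *m S = char_poly_mx (adj_mx F (hat G)).
  rewrite /char_poly_mx map_adj_mx.
  rewrite adj_mx_hat // raddfD opprD opprB !addrA.
  by rewrite addrAC.
(* The scalar part is X(X + 2) - 3(X + 1) = X^2 - X - 3, and the rest is the adjacency matrix of
   [G]. *)
have -> : c%:M - S *m (('X + 1)%:M + T) *m S^T =
    map_mx (comp_poly ('X ^+ 2 - 'X - 3%:P)) (char_poly_mx (adj_mx F G)).
  rewrite mulmxDr mulmxDl src_flip_mx // scalar_mxC -mulmxA src_mxK //.
  rewrite -scalar_mxM opprD addrA -raddfB /char_poly_mx map_mxB map_scalar_mx.
  congr (_ - _); last first.
    by apply/matrixP => i j; rewrite !mxE /= comp_polyC polyC_natr.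
  congr (_%:M); rewrite /= comp_polyX !polyC_natr.
  ring.
rewrite det_map_mx -!/(char_poly _); move: (char_poly (adj_mx F (hat G))) => chi.
(* The two sides carry powers of [c] with exponents 5k and 6k; cancelling leaves [c ^+ k]. *)
have -> : #|hat G| = (k + (3 * k + #|G|))%N by rewrite card_hat // Gk; lia.
by rewrite [_ ^+ (k + _)]exprD mulrAC => /(mulIf (expf_neq0 _ c_neq0)).
Qed.
End HatCharPoly.

(** The adjacency matrix is the all-ones matrix minus the identity, a rank one perturbation of a
    scalar, so the Schur complement has size 1. *)
Lemma char_poly_complete (F : fieldType) (V : finType) n :
  #|V| = n.+1 ->
  char_poly (adj_mx F (complete V)) = ('X - n%:R%:P) * ('X + 1) ^+ n.
Proof.
move=> Vn; have X1 : 'X + 1 != 0 :> {poly F} by rewrite -[1]opprK -(polyCN 1) polyXsubC_eq0.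
pose one : 'cV[{poly F}]_#|complete V| := const_mx 1.
have M1 : ('X + 1 : {poly F})%:M *m 1%:M = ('X + 1)%:M :> 'M_#|complete V|.
  by rewrite mulmx1.
have := det_sub_mulmx_scaled one one^T M1; rewrite det1 mul1r.
have -> : ('X + 1)%:M - one *m one^T = char_poly_mx (adj_mx F (complete V)).
  apply/matrixP => i j; rewrite !mxE big_ord1 !mxE mulr1 polyC_natr.
  have -> : adj (enum_val i) (enum_val j) = (i != j).
    by rewrite -(inj_eq enum_val_inj).
  by case: eqP; rewrite ?mulr1n ?mulr0n ?subr0 // addrK.
rewrite mulmx1 [\det (_%:M - one^T *m _)]det_mx11 !mxE mulr1n.
under eq_bigr => i _ do rewrite !mxE mulr1.
rewrite -/(char_poly _) sumr_const card_ord expr1.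
move: (char_poly _) => chi; rewrite card_complete Vn exprSr mulrAC.
move/(mulIf X1) ->; rewrite polyC_natr mulrC; congr (_ * _).
by rewrite -(natr1 n) opprD addrACA subrr addr0.
Qed.

Lemma comp_poly_exp (K : comNzRingType) (p q : {poly K}) n :
  (p ^+ n) \Po q = (p \Po q) ^+ n.
Proof. exact: rmorphXn. Qed.

Lemma comp_poly_prod (K : comNzRingType) I (r : seq I) (P : pred I)
    (E : I -> {poly K}) q :
  (\prod_(i <- r | P i) E i) \Po q = \prod_(i <- r | P i) (E i \Po q).
Proof. exact: rmorph_prod. Qed.

(** [f_iter] adds [f_poly] on the outside, while [char_poly_hat] substitutes it on the inside. *)
Lemma f_iterSr (R : realType) p : f_iter R p.+1 = f_iter R p \Po f_poly R.
Proof.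
elim: p => [|p IH]; first by rewrite /f_iter /= comp_polyX comp_polyXr.
by rewrite [LHS]/f_iter iterS -/(f_iter R p.+1) {1}IH comp_polyA.
Qed.

Lemma char_poly_Gamma (R : realType) n :
     char_poly (adj_mx R[i] (Gamma n)) =
     ('X - 3%:P) * ('X + 1) ^+ 3 *
     \prod_(p < n)
       ((m_poly R \Po f_iter R p) ^+ 3 *
        (l_poly R \Po f_iter R p) ^+ (2 * 3 ^ (n - 1 - p)) *
        (k_poly R \Po f_iter R p) ^+ (1 + 2 * 3 ^ (n - 1 - p))).
Proof.
elim: n => [|n IH].
  by rewrite big_ord0 mulr1; exact: char_poly_complete (card_ord 4).
rewrite [Gamma _]/= (char_poly_hat _ (@Gamma_cubic n) (card_Gamma n)) IH.
rewrite -/(f_poly R) 2!comp_polyM comp_poly_exp comp_poly_prod big_ord_recl /=.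
rewrite {1 2 3}/f_iter /= !comp_polyXr subn0 subSS subn0.
rewrite comp_polyB comp_polyD comp_polyX -polyC1 !comp_polyC polyC1.
rewrite (_ : f_poly R - 3%:P = ('X - 3%:P) * k_poly R); last first.
  by rewrite /f_poly /k_poly !polyC_natr; ring.
rewrite (_ : f_poly R + 1 = m_poly R * ('X + 1)); last first.
  by rewrite /f_poly /m_poly !polyC_natr; ring.
(* The factor at index 0 collects [m_poly] cubed from [f_poly R + 1], one [k_poly] from
   [f_poly R - 3%:P], and the powers of [l_poly] and [k_poly] from the prefactor of
   [char_poly_hat]. *)
rewrite -/(k_poly R) -/(l_poly R) !exprMn exprD expr1.
rewrite (eq_bigr (fun p : 'I_n => (m_poly R \Po f_iter R (lift ord0 p)) ^+ 3 *
  (l_poly R \Po f_iter R (lift ord0 p)) ^+ (2 * 3 ^ (n - lift ord0 p)) *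
  (k_poly R \Po f_iter R (lift ord0 p)) ^+ (1 + 2 * 3 ^ (n - lift ord0 p)))).
  ring.
move=> p _; rewrite 2!comp_polyM !comp_poly_exp -!comp_polyA lift0 -f_iterSr.
by rewrite -subnDA add1n.
Qed.

Theorem mainTheorem2 (R : realType) :
  (forall m n : nat, (n <= m)%N ->
     (exists pi : Gamma m -> Gamma n, covering pi) /\
     (exists pi : pascal -> Gamma n, covering pi)) /\
  (forall n : nat,
     char_poly_end (Delta R (Gamma n)) =
     ('X - 3%:P) * ('X + 1) ^+ 3 *
     \prod_(p < n)
       ((m_poly R \Po f_iter R p) ^+ 3 *
        (l_poly R \Po f_iter R p) ^+ (2 * 3 ^ (n - 1 - p)) *
        (k_poly R \Po f_iter R p) ^+ (1 + 2 * 3 ^ (n - 1 - p)))).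
Proof.
split=> [m n nm|n]; last by rewrite char_poly_Delta char_poly_Gamma.
by split; [apply: Gamma_covering|apply: pascal_covering].
Qed.
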